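(* Let $n\ge 2$ and let $\mathcal{G}=(\mathcal{V},\mathcal{E}_1,\emptyset)$ be such that $\mathcal{G}_1=(\mathcal{V},\mathcal{E}_1)$ is connected and non-bipartite with $n$ vertices. Assume that there exists a maximal independent set $\mathcal{S}(\mathcal{G}_1)$ of $\mathcal{G}_1$ such that every vertex in the set has a self-loop. Then there exists an instance $\mathcal{P}_{\mathbf{M}^*,\Omega,n,1}$ in $\mathcal{L}(\mathcal{G},n,1)$ for which the problem $\min_{\mathbf{x}\in\mathbb{R}^n}\|(\mathbf{x}\mathbf{x}^T-\mathbf{M}^* )_\Omega\|_F^2$ has at least $2^{|\mathcal{S}(\mathcal{G}_1)|}-2$ spurious local minima.
   Context: For $\Omega\subset[n]\times[n]$, $\mathbf{M}_\Omega$ denotes the matrix whose $(i,j)$ entry is $\mathbf{M}_{ij}$ if $(i,j)\in\Omega$ and $0$ otherwise. The problem $\mathcal{P}_{\mathbf{M}^*,\Omega,n,1}$ is: find $\mathbf{M}\in\mathbb{R}^{n\times n}$ with $\mathrm{rank}(\mathbf{M})\le 1$, $\mathbf{M}\succeq 0$, $\mathbf{M}_\Omega=\mathbf{M}^*_\Omega$. Graphs are undirected with node set $\mathcal{V}=[n]$, may have self-loops, and edge sets are regarded as symmetric subsets of $[n]\times[n]$; a self-loop counts as an odd cycle for (non-)bipartiteness. For $\mathcal{G}=(\mathcal{V},\mathcal{E}_1,\emptyset)$ and $r=1$, the induced measurement set is $\Omega(\mathcal{G})=\mathcal{E}_1$. The class $\mathcal{L}(\mathcal{G},n,1)$ consists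 of the problems $\mathcal{P}_{\mathbf{M}^*,\Omega,n,1}$ such that $\mathbf{M}^*$ is a PSD $n\times n$ matrix of rank $1$, all entries of $\mathbf{M}^*$ are nonzero, and $\Omega=\Omega(\mathcal{G})$ with $\mathcal{G}_1$ connected and non-bipartite. An independent set is a set of nodes no two (distinct) of which are adjacent; it is maximal if it is not a strict subset of another independent set. A solution is called spurious if it is a local minimum but has a larger objective value than the optimal objective value. *)

(* Defs.v *)
From mathcomp Require Export all_boot all_order all_algebra.
From mathcomp Require Export all_classical all_reals all_analysis.

#[global] Set Implicit Arguments.
#[global] Unset Strict Implicit.
#[global] Unset Printing Implicit Defensive.

Import Order.TTheory GRing.Theory Num.Theory.
Import numFieldNormedType.Exports.

Local Open Scope classical_set_scope.
Local Open Scope ring_scope.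

(* A graph on the node set [n] is given by its edge set, a symmetric subset of
   [n] x [n]; a pair (i, i) is a self-loop at i. *)
Definition edge_set (n : nat) := {set 'I_n * 'I_n}.

Definition adj (n : nat) (E : edge_set n) : rel 'I_n :=
  fun i j => (i, j) \in E.

Definition undirected (n : nat) (E : edge_set n) : Prop := symmetric (adj E).

Definition connected_graph (n : nat) (E : edge_set n) : Prop :=
  forall i j : 'I_n, connect (adj E) i j.

(* The two parts are A and its complement. For i = j the condition cannot hold,
   so a graph with a self-loop is not bipartite. *)
Definition bipartite (n : nat) (E : edge_set n) : Prop :=
  exists A : {set 'I_n}, forall i j : 'I_n,
    adj E i j -> (i \in A) != (j \in A).

(* Self-loops are allowed inside an independent set: only distinct nodes count. *)
Definition independent_set (n : nat) (E : edge_set n) : pred {set 'I_n} :=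
  fun A => [forall i in A, forall j in A, (i != j) ==> ~~ adj E i j].

Definition maximal_independent_set (n : nat) (E : edge_set n) (A : {set 'I_n})
  : bool := maxset (independent_set E) A.

Definition psd (R : realType) (n : nat) (M : 'M[R]_n) : Prop :=
  M^T = M /\ forall x : 'cV[R]_n, 0 <= (x^T *m M *m x) ord0 ord0.

Definition mx_restrict (R : realType) (n : nat) (Omega : {set 'I_n * 'I_n})
    (M : 'M[R]_n) : 'M[R]_n :=
  \matrix_(i, j) if (i, j) \in Omega then M i j else 0.

(* The norm `|M| on matrices in MathComp-Analysis is the max norm. *)
Definition frobenius_norm (R : realType) (n : nat) (M : 'M[R]_n) : R :=
  Num.sqrt (\sum_i \sum_j M i j ^+ 2).

(* The data of the matrix completion problem of search rank 1:
   the ground truth M^* and the measurement set Omega. *)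
Record problem (R : realType) (n : nat) := Problem {
  ground_truth : 'M[R]_n;
  measurements : {set 'I_n * 'I_n}
}.

Definition is_solution (R : realType) (n : nat) (P : problem R n)
    (M : 'M[R]_n) : Prop :=
  [/\ (\rank M <= 1)%N, psd M &
      mx_restrict (measurements P) M =
      mx_restrict (measurements P) (ground_truth P)].

(* The class L(G, n, 1) for G = (V, E, emptyset). In rank 1 the measurement
   set induced by G is E itself. *)
Definition problem_class (R : realType) (n : nat) (E : edge_set n)
    (P : problem R n) : Prop :=
  [/\ psd (ground_truth P) /\ \rank (ground_truth P) = 1%N,
      forall i j : 'I_n, ground_truth P i j != 0,
      measurements P = E,
      connected_graph E &
      ~ bipartite E].

Definition objective (R : realType) (n : nat) (P : problem R n)
    (x : 'cV[R]_n) : R :=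
  frobenius_norm
    (mx_restrict (measurements P) (x *m x^T - ground_truth P)) ^+ 2.

Definition local_minimum (R : realType) (n : nat) (f : 'cV[R]_n -> R)
    (x : 'cV[R]_n) : Prop :=
  \forall y \near x, f x <= f y.

(* inf of a set with no lower bound is 0 by convention; this is harmless for
   the nonnegative function objective P. *)
Definition spurious_local_minimum (R : realType) (n : nat)
    (f : 'cV[R]_n -> R) (x : 'cV[R]_n) : Prop :=
  local_minimum f x /\ inf (range f) < f x.

(* Main.v *)
Require Import Defs.
From mathcomp Require Import all_boot all_order all_algebra.
From mathcomp Require Import all_classical all_reals all_analysis.
From mathcomp Require Import lra.

Import Order.TTheory GRing.Theory Num.Theory.
Import numFieldNormedType.Exports.

Local Open Scope classical_set_scope.
Local Open Scope ring_scope.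
Local Open Scope card_scope.

(* Take M^* = z z^T with z = 1 on S and a small eps > 0 off S. For every choice
   of signs on S let c be that sign vector on S and 0 off S. By maximality of S
   every node off S has a neighbour in S, and with the loops on S this keeps the
   objective bounded away from 0 on the boundary of the box of radius 1/2 around
   c, while the objective at c tends to 0 with eps. So for small eps the minimum
   over the box is interior. Its value is 0 only if all coordinates of the
   minimizer have the same sign, by connectedness; this rules out all but two of
   the 2^|S| choices of signs. *)

(** * Interior minima over a box *)

Lemma local_minimum_in_box (R : realType) (n : nat) (f : 'cV[R]_n -> R)
    (c : 'cV[R]_n) (r : R) :
  0 < r -> continuous f ->
  (forall (y : 'cV[R]_n) i, (forall j, `|y j ord0 - c j ord0| <= r) ->
    `|y i ord0 - c i ord0| = r -> f c < f y) ->
  exists2 x, local_minimum f x & forall i, `|x i ord0 - c i ord0| < r.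
Proof.
move=> r0 fc fbd.
pose A i := `[c i ord0 - r, c i ord0 + r]%classic.
(* The box lives on row vectors, where [rV_compact] applies; transposition carries it over to
   columns. *)
pose B := [set v : 'rV[R]_n | forall i, A i (v ord0 i)].
have BE v : B v <-> forall j, `|v^T j ord0 - c j ord0| <= r.
  by split=> H j; have := H j; rewrite /A /= in_itv /= ?mxE ler_distl.
have cB : compact B by apply: rV_compact => i; exact: segment_compact.
have Bc : B c^T by apply/BE => j; rewrite trmxK subrr normr0 ltW.
have trc : continuous (fun v : 'rV[R]_n => v^T : 'cV[R]_n).
  move=> v s /= /(nbhs_ballP (v^T)) [e e0 es].
  apply/nbhs_ballP; exists e => //= w [_ vw]; apply: es; split => // i j.
  by rewrite !mxE; exact: vw.
have gc : {within B, continuous (fun v : 'rV[R]_n => f v^T)}.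
  apply: continuous_subspaceT => v.
  exact: (@continuous_comp _ _ _ (fun v : 'rV[R]_n => v^T) f _ (trc v) (fc _)).
have [v /set_mem /BE vB vmin] := compact_EVT_min (ex_intro _ _ Bc) cB gc.
have vlt i : `|v^T i ord0 - c i ord0| < r.
  (* A minimizer on a face of the box would beat the centre [c], which lies in the box, against
     [fbd]. *)
  rewrite lt_neqAle vB andbT; apply/negP => /eqP vr.
  have := fbd _ _ vB vr; rewrite ltNge => /negP; apply.
  by have := vmin _ (mem_set Bc); rewrite trmxK.
exists v^T => //; rewrite /local_minimum.
have H : nbhs (v^T : 'cV[R]_n)
    [set y : 'cV[R]_n | forall i, `|y i ord0 - c i ord0| < r].
  apply: (@filter_forall _ _ (fun i (y : 'cV[R]_n) => `|y i ord0 - c i ord0| < r)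
    _ (nbhs_filter _)) => i.
  have h : continuous (fun y : 'cV[R]_n => `|y i ord0 - c i ord0|).
    move=> y; apply: (@cvg_norm _ _ _ (nbhs y) _
      (fun y : 'cV[R]_n => y i ord0 - c i ord0) (y i ord0 - c i ord0)).
    apply: cvgB; last exact: cvg_cst.
    exact: coord_continuous.
  exact: (cvgr_lt _ (h v^T) r (vlt i)).
apply: filterS H => y yr.
rewrite -[y]trmxK; apply: vmin; apply/mem_set/BE => j.
by rewrite trmxK ltW.
Qed.

(** * The objective as a sum of squares over edges *)

Lemma objectiveE (R : realType) (n : nat) (E : edge_set n) (z x : 'cV[R]_n) :
  objective (Problem (z *m z^T) E) x =
  \sum_i \sum_j (if adj E i j then
    x i ord0 * x j ord0 - z i ord0 * z j ord0 else 0) ^+ 2.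
Proof.
rewrite /objective /frobenius_norm sqr_sqrtr; last first.
  by do 2!apply: sumr_ge0 => ? _; exact: sqr_ge0.
do 2!(apply: eq_bigr => ? _); rewrite !mxE /adj /=.
by case: ifP => //; rewrite !big_ord1 !mxE.
Qed.

Lemma objective_ge0 (R : realType) (n : nat) (P : problem R n) (x : 'cV[R]_n) :
  0 <= objective P x.
Proof. exact: sqr_ge0. Qed.

Lemma objective_ge_edge (R : realType) (n : nat) (E : edge_set n)
    (z x : 'cV[R]_n) (i j : 'I_n) :
  adj E i j -> (x i ord0 * x j ord0 - z i ord0 * z j ord0) ^+ 2 <=
               objective (Problem (z *m z^T) E) x.
Proof.
move=> Eij; rewrite objectiveE (bigD1 i) //= (bigD1 j) //= Eij -addrA lerDl.
by rewrite addr_ge0 ?sumr_ge0 // => *; rewrite ?sumr_ge0 // => *; rewrite sqr_ge0.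
Qed.

Lemma objective_continuous (R : realType) (n : nat) (E : edge_set n)
    (z : 'cV[R]_n) : continuous (objective (Problem (z *m z^T) E)).
Proof.
rewrite (_ : objective _ = fun x => \sum_i \sum_j (if adj E i j then
    x i ord0 * x j ord0 - z i ord0 * z j ord0 else 0) ^+ 2); last first.
  by apply/funext => x; exact: objectiveE.
apply: continuous_big => [|i _]; first exact: add_continuous.
apply: continuous_big => [|j _]; first exact: add_continuous.
case: (adj E i j); last by move=> x; exact: (@cvg_cst _ _ _ (nbhs x)).
have h : continuous (fun x : 'cV[R]_n =>
    x i ord0 * x j ord0 - z i ord0 * z j ord0).
  move=> y; apply: (@cvgB _ _ _ (nbhs y)); last exact: cvg_cst.
  apply: (@cvgM _ _ (nbhs y)); exact: coord_continuous.
by move=> x; apply: (@cvgM _ _ (nbhs x)); exact: h.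
Qed.

(** * Ground truths of the form [z *m z^T] *)

Lemma psd_outer (R : realType) (n : nat) (z : 'cV[R]_n) : psd (z *m z^T).
Proof.
split=> [|x]; first by rewrite trmx_mul trmxK.
have -> : x^T *m (z *m z^T) *m x = (z^T *m x)^T *m (z^T *m x).
  by rewrite trmx_mul trmxK !mulmxA.
by rewrite mxE big_ord1 mxE -expr2 sqr_ge0.
Qed.

Lemma rank_outer (R : realType) (n : nat) (z : 'cV[R]_n) :
  z != 0 -> \rank (z *m z^T) = 1%N.
Proof.
move=> z0; apply/eqP; rewrite eqn_leq; apply/andP; split.
  by rewrite (leq_trans (mxrankM_maxl _ _)) ?rank_leq_col.
rewrite lt0n mxrank_eq0; apply: contra z0 => /eqP/matrixP H.
apply/eqP/colP => i; have := H i i; rewrite !mxE big_ord1 !mxE.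
by move/eqP; rewrite mulf_eq0 orbb => /eqP.
Qed.

(** * Independence and connectedness *)

Lemma maximal_independent_set_dominating (n : nat) (E : edge_set n)
    (S : {set 'I_n}) (j : 'I_n) :
  undirected E -> maximal_independent_set E S -> j \notin S ->
  exists2 i, i \in S & adj E i j.
Proof.
move=> Esym /maxsetP[indS maxS] jS.
have [/exists_inP//|noi] := boolP [exists i in S, adj E i j].
have noadj i : i \in S -> ~~ adj E i j.
  by move=> iS; apply: contra noi => ij; apply/exists_inP; exists i.
(* If [j] had no neighbour in [S], it could be added to [S], against maximality; a loop at [j] does
   no harm. *)
suff ind : independent_set E (j |: S).
  by case/negP: jS; rewrite -(maxS _ ind (finset.subsetUr _ _)) finset.setU11.
apply/forall_inP => a /setU1P aS; apply/forall_inP => b /setU1P bS.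
case: aS bS => [->|aS] [->|bS]; first by rewrite eqxx.
- by rewrite Esym noadj ?implybT.
- by rewrite noadj ?implybT.
- by move/forall_inP: indS => /(_ a aS) /forall_inP /(_ b bS).
Qed.

Lemma connected_const (n : nat) (E : edge_set n) (T : Type)
    (g : 'I_n -> T) :
  connected_graph E -> (forall i j, adj E i j -> g i = g j) ->
  forall i j, g i = g j.
Proof.
move=> Ecn gE i j; have /connectP[p] := Ecn i j.
elim: p i => [|k p IH] i /=; first by move=> _ ->.
by move=> /andP[/gE-> /IH].
Qed.

(** * The instance and its spurious minima *)

Section SpuriousMinima.
Context {R : realType} {n : nat}.
Variables (E : edge_set n) (S : {set 'I_n}).

(* With this value the objective at a sign vector is at most n^2 eps^2 = 1/256,
   below its lower bound 1/64 on the boundary of the box. *)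
Definition eps : R := (16 * n%:R)^-1.

Definition truth_vec : 'cV[R]_n := \col_i (if i \in S then 1 else eps).

Definition sign_vec (T : {set 'I_n}) : 'cV[R]_n :=
  \col_i (if i \in T then 1 else if i \in S then -1 else 0).

Let z := truth_vec.
Let P := Problem (z *m z^T) E.

Hypothesis n2 : (2 <= n)%N.

Lemma eps_gt0 : 0 < eps.
Proof. by rewrite invr_gt0 mulr_gt0 // ltr0n ltnW. Qed.

Lemma eps_muln : eps * n%:R = 1 / 16.
Proof.
have n0 : n%:R != 0 :> R by rewrite pnatr_eq0; case: n n2.
by rewrite /eps invfM mulfVK // div1r.
Qed.

Lemma eps_le : eps <= 1 / 32.
Proof.
have := eps_gt0; have := eps_muln; have : 2 <= n%:R :> R by rewrite (ler_nat R 2).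
nra.
Qed.

Lemma truth_vec_gt0 i : 0 < z i ord0.
Proof. by rewrite mxE; case: ifP => // _; exact: eps_gt0. Qed.

Lemma truth_vec_mul_le i j : (i \notin S) || (j \notin S) ->
  0 <= z i ord0 * z j ord0 <= eps.
Proof.
rewrite !mxE; have := eps_gt0; have := eps_le.
by case: (i \in S); case: (j \in S) => //= ? ? _; apply/andP; nra.
Qed.

Lemma truth_problem_class :
  connected_graph E -> ~ bipartite E -> problem_class E P.
Proof.
move=> Ecn Enb; split=> //=.
- split; first exact: psd_outer.
  have i0 : 'I_n by exact: (Ordinal (ltnW n2)).
  apply: rank_outer; apply/eqP => /matrixP /(_ i0 ord0) /eqP.
  by rewrite [X in _ == X]mxE gt_eqF // truth_vec_gt0.
- by move=> i j; rewrite mxE big_ord1 [z^T _ _]mxE gt_eqF // mulr_gt0 // truth_vec_gt0.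
Qed.

Lemma objective_truth : objective P z = 0.
Proof.
rewrite objectiveE big1 // => i _; rewrite big1 // => j _.
by rewrite subrr if_same expr0n.
Qed.

Lemma inf_objective_le0 : inf (range (objective P)) <= 0.
Proof.
rewrite -objective_truth; apply: ge_inf; last by exists z.
by exists 0 => _ [x _ <-]; exact: objective_ge0.
Qed.

(** Edges inside [S] are loops, where [(-1)^2 = 1^2 = 1] leaves no error. On any other edge the
    product of signs is 0 and the true entry is at most [eps], so each of the [n^2] terms is at most
    [eps^2]. *)
Lemma objective_sign_vec_lt (T : {set 'I_n}) :
  independent_set E S -> T \subset S -> objective P (sign_vec T) < 1 / 64.
Proof.
move=> indS TS; rewrite objectiveE.
apply: (@le_lt_trans _ _ (\sum_(i < n) \sum_(j < n) eps ^+ 2)); last first.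
  rewrite !(sumr_const, card_ord) -mulrnA -[eps ^+ 2 *+ _]mulr_natr natrM.
  rewrite -expr2 -exprMn eps_muln.
  lra.
apply: ler_sum => i _; apply: ler_sum => j _.
case: ifP => [Eij|_]; last by rewrite expr0n sqr_ge0.
have [/andP[iS jS]|] := boolP ((i \in S) && (j \in S)).
  have <- : i = j.
    apply/eqP; move/forall_inP: indS => /(_ i iS) /forall_inP /(_ j jS).
    by rewrite Eij implybF negbK.
  rewrite !mxE iS; case: (i \in T); rewrite ?mulrNN mul1r subrr expr0n; exact: sqr_ge0.
rewrite negb_and => ijS; have /andP[z0 ze] := truth_vec_mul_le ijS.
suff -> : sign_vec T i ord0 * sign_vec T j ord0 = 0.
  by rewrite sub0r sqrrN ler_sqr ?nnegrE // ltW // eps_gt0.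
rewrite !mxE; case/orP: ijS => kS.
  by rewrite (negbTE kS) (contraNF (fintype.subsetP TS _) kS) mul0r.
by rewrite (negbTE kS) (contraNF (fintype.subsetP TS _) kS) mulr0.
Qed.

(** One edge at the extremal coordinate [i] suffices. If [i] is in [S], its loop does: [y i] is at
    distance 1/2 from 1 or -1, so its square is 1/4 or 9/4, far from 1. Otherwise the edge to a
    neighbour in [S] does. *)
Lemma objective_box_boundary (T : {set 'I_n}) (y : 'cV[R]_n) (i : 'I_n) :
  undirected E -> maximal_independent_set E S ->
  (forall j, j \in S -> adj E j j) -> T \subset S ->
  (forall j, `|y j ord0 - sign_vec T j ord0| <= 1 / 2) ->
  `|y i ord0 - sign_vec T i ord0| = 1 / 2 -> 1 / 64 <= objective P y.
Proof.
move=> Esym maxS loopS TS ybox yi.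
have [iS|iS] := boolP (i \in S).
  apply: le_trans (objective_ge_edge z y (loopS i iS)).
  move: yi; rewrite !mxE iS.
  by case: (i \in T); case: ler0P => ? ?; nra.
have [j jS Eji] := maximal_independent_set_dominating Esym maxS iS.
apply: le_trans (objective_ge_edge z y Eji).
have /andP[] : 0 <= z j ord0 * z i ord0 <= eps.
  by apply: truth_vec_mul_le; rewrite iS orbT.
have := eps_le; move: eps (z j ord0 * z i ord0) => e w e32 w0 we.
have iT : (i \in T) = false by apply: contraNF iS => /(fintype.subsetP TS).
have yj : 1 / 2 <= `|y j ord0|.
  have := ybox j; rewrite !mxE jS.
  by case: (j \in T); rewrite ler_distl => /andP[? ?]; case: ler0P => ?; lra.
have {}yi : `|y i ord0| = 1 / 2.
  by move: yi; rewrite !mxE (negbTE iS) iT subr0.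
(* The true entry [w] lies in [[0, 1/32]], so [t] misses it by at least 1/8 whatever the sign of
   [t]. *)
have : 1 / 4 <= `|y j ord0 * y i ord0| by rewrite normrM yi; lra.
move: (y j ord0 * y i ord0) => t; case: ler0P => ? ?.
  have : t - w <= - (1 / 8) by lra.
  by nra.
have : 1 / 8 <= t - w by lra.
by nra.
Qed.

(** At value 0 the product along each edge equals a positive true entry, so signs agree across edges
    and connectedness spreads this to all nodes. *)
Lemma objective_eq0_same_sign (x : 'cV[R]_n) :
  connected_graph E -> objective P x = 0 ->
  forall i j, (0 < x i ord0) = (0 < x j ord0).
Proof.
move=> Ecn fx0.
apply: (connected_const (g := fun i => 0 < x i ord0) Ecn) => i j Eij.
have : 0 < x i ord0 * x j ord0.
  have := objective_ge_edge z x Eij.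
  rewrite -/P fx0 => H.
  have /eqP : (x i ord0 * x j ord0 - z i ord0 * z j ord0) ^+ 2 = 0.
    by apply/eqP; rewrite eq_le H sqr_ge0.
  rewrite sqrf_eq0 subr_eq0 => /eqP ->.
  by rewrite mulr_gt0 // truth_vec_gt0.
by case: (ltP 0 (x i ord0)) => a; case: (ltP 0 (x j ord0)) => b //; nra.
Qed.

(** Radius 1/2 is too small to reverse a sign, so [T] can be read off any point of its box; this is
    what later separates the minima. *)
Lemma sign_vec_box (T : {set 'I_n}) (x : 'cV[R]_n) (i : 'I_n) :
  i \in S -> `|x i ord0 - sign_vec T i ord0| < 1 / 2 ->
  (0 < x i ord0) = (i \in T).
Proof.
move=> iS; rewrite !mxE iS ltr_distl => /andP[].
by case: (i \in T) => ? ?; [apply/idP | apply/negbTE; rewrite -leNgt]; lra.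
Qed.

Lemma spurious_near_sign_vec (T : {set 'I_n}) :
  undirected E -> connected_graph E -> maximal_independent_set E S ->
  (forall j, j \in S -> adj E j j) ->
  T \subset S -> T != finset.set0 -> T != S ->
  exists2 x, spurious_local_minimum (objective P) x &
    forall i, i \in S -> (0 < x i ord0) = (i \in T).
Proof.
move=> Esym Ecn maxS loopS TS T0 TnS.
have fcT : objective P (sign_vec T) < 1 / 64.
  by apply: objective_sign_vec_lt => //; case/maxsetP: maxS.
have [||y i ybox yi|x xmin xbox] :=
    @local_minimum_in_box _ _ (objective P) (sign_vec T) (1 / 2).
- lra.
- exact: objective_continuous.
- exact/(lt_le_trans fcT)/(objective_box_boundary Esym maxS loopS TS ybox yi).
have xT i : i \in S -> (0 < x i ord0) = (i \in T).
  by move=> iS; exact: sign_vec_box.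
exists x => //; split=> //.
apply: le_lt_trans inf_objective_le0 _; rewrite lt_neqAle objective_ge0 andbT.
apply/eqP => /esym fx0.
(* Since [T] is neither empty nor [S], [x] takes both signs on [S], which value 0 forbids. *)
have [i iT] := finset.set0Pn _ T0.
have [j jS jT] : exists2 j, j \in S & j \notin T.
  by apply/subsetPn; move: TnS; rewrite finset.eqEsubset TS.
have := objective_eq0_same_sign Ecn fx0 i j.
by rewrite (xT i (fintype.subsetP TS _ iT)) (xT j jS) iT (negbTE jT).
Qed.

End SpuriousMinima.

(** * Counting the minima *)

Lemma card_proper_nonempty_subsets (T : finType) (S : {set T}) :
  (2 ^ #|S| - 2 <=
    #|[set A in powerset S | (A != finset.set0) && (A != S)]%SET|)%N.
Proof.
rewrite -card_powerset leq_subLR.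
have : powerset S \subset
    [set finset.set0; S]%SET :|: [set A in powerset S | (A != finset.set0) && (A != S)]%SET.
  apply/fintype.subsetP => A; rewrite !inE => ->.
  by case: (A == finset.set0); case: (A == S).
move/subset_leq_card/leq_trans; apply.
rewrite (leq_trans (leq_card_setU _ _)) // leq_add2r.
(* The two excluded sets coincide when [S] is empty; at most 2 is enough. *)
by rewrite cards2; case: (_ == _).
Qed.

(** A choice of witnesses is injective on [D] because a witness determines its index through [Q].
    The set [B] may be infinite, hence the comparison with [I_m]. *)
Lemma card_le_of_witnesses (I : finType) (U : Type) (D : {set I}) (B : set U) (m : nat)
    (Q : I -> U -> Prop) :
  (m <= #|D|)%N -> (forall a, a \in D -> exists2 x, B x & Q a x) ->
  (forall a b x, a \in D -> b \in D -> Q a x -> Q b x -> a = b) ->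
  `I_m #<= B.
Proof.
move=> mD ex inj.
(* A positive [m] supplies an element of [D], needed as default for [nth] and, through its witness,
   for the choice outside [D]. *)
have [->|m0] := posnP m; first by rewrite II0 card_ge0.
have [a0 a0D] : exists a, a \in D by apply/card_gt0P; exact: leq_trans mD.
have [u0 _ _] := ex a0 a0D.
have ch a : exists x, a \in D -> B x /\ Q a x.
  by case: (boolP (a \in D)) => [/ex[x ? ?]|_]; [exists x | exists u0].
have [h hP] := choice ch.
pose e k := nth a0 (enum D) k.
have eD k : (k < m)%N -> e k \in D.
  by move=> km; rewrite -mem_enum mem_nth // -cardE (leq_trans km).
apply: (@card_le_trans _ _ _ ((h \o e) @` `I_m)); last first.
  by apply: subset_card_le => _ [k /= km <-]; have [] := hP _ (eD k km).
have hinj : set_inj `I_m (h \o e).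
  move=> k l /set_mem /= km /set_mem /= lm hkl.
  have /eqP : e k = e l.
    apply: (inj _ _ (h (e k))); rewrite ?eD //.
      by have [] := hP _ (eD k km).
    by rewrite hkl; have [] := hP _ (eD l lm).
  by rewrite nth_uniq ?enum_uniq -?cardE ?(leq_trans km) ?(leq_trans lm) // => /eqP.
by have := inj_card_eq hinj; rewrite card_eq_sym => /card_eqPle[].
Qed.

Theorem theorem1 (R : realType) (n : nat) (hn : (2 <= n)%N)
  (E : edge_set n) (hsym : undirected E)
  (hconn : connected_graph E) (hnbip : ~ bipartite E)
  (S : {set 'I_n}) (hS : maximal_independent_set E S)
  (hloop : forall i : 'I_n, i \in S -> adj E i i) :
  exists P : problem R n, problem_class E P /\
    `I_(2 ^ #|S| - 2) #<= [set x | spurious_local_minimum (objective P) x].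
Proof.
exists (Problem (truth_vec S *m (truth_vec S)^T) E).
split; first exact: truth_problem_class.
apply: (card_le_of_witnesses (Q := fun (A : {set 'I_n}) (x : 'cV[R]_n) =>
  forall i, i \in S -> (0 < x i ord0) = (i \in A))
  (card_proper_nonempty_subsets S)) => [A|A B x].
  by rewrite !inE => /and3P[AS A0 AnS]; exact: spurious_near_sign_vec.
rewrite !inE => /andP[/fintype.subsetP AS _] /andP[/fintype.subsetP BS _] xA xB.
(* The signs of [x] fix membership on [S], and both sets are empty off [S]. *)
apply/setP => i; have [iS|iS] := boolP (i \in S); first by rewrite -xA // -xB.
by rewrite (contraNF (AS i) iS) (contraNF (BS i) iS).
Qed.
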